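(* Let $k\geq 1$ be an integer, and let $G$ be a finite nilpotent group such that, for every prime $p$ dividing $|G|$, the Sylow $p$-subgroup of $G$ has order at most $p^k$. Then $G$ is totally $k$-closed if and only if, for every prime $p$, $G$ does not contain a subgroup isomorphic to the elementary abelian group $\mathbb{Z}_p^k$.
   Context: Let $k$ be a positive integer. For a permutation group $G\leq \mathrm{Sym}(\Omega)$ on a set $\Omega$, the $k$-closure $G^{(k)}$ of $G$ is the group of all permutations $g\in\mathrm{Sym}(\Omega)$ that preserve (setwise) each $G$-orbit in the induced (coordinatewise) action of $G$ on the set $\Omega^k=\Omega\times\dots\times\Omega$ of ordered $k$-tuples. A permutation group $G$ is $k$-closed if $G^{(k)}=G$. An abstract group $G$ is totally $k$-closed if, for every faithful permutation representation of $G$ on a set $\Omega$, the image of $G$ in $\mathrm{Sym}(\Omega)$ is $k$-closed. Here $\mathbb{Z}_p^k$ denotes the direct product of $k$ copies of the cyclic group of order $p$. *)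

(* Defs.v *)
From mathcomp Require Import all_boot all_fingroup all_solvable all_algebra.
From mathcomp Require Import boolp classical_sets.

Set Implicit Arguments.
Unset Strict Implicit.
Unset Printing Implicit Defensive.

Local Open Scope classical_set_scope.

(* Permutations of an arbitrary, possibly infinite, Omega are bijective
   functions Omega -> Omega, and permutation groups are sets of these. *)
Definition SymSet (Omega : Type) : set (Omega -> Omega) :=
  [set g | bijective g].

Definition tuple_orbit (Omega : Type) (k : nat) (P : set (Omega -> Omega))
    (t : k.-tuple Omega) : set (k.-tuple Omega) :=
  [set map_tuple h t | h in P].

Definition kclosure (Omega : Type) (k : nat) (P : set (Omega -> Omega)) :
    set (Omega -> Omega) :=
  [set g | SymSet g /\
     forall t : k.-tuple Omega,
       map_tuple g @` tuple_orbit P t = tuple_orbit P t].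

Definition kclosed (Omega : Type) (k : nat) (P : set (Omega -> Omega)) : Prop :=
  kclosure k P = P.

Section Representations.

Variables (gT : finGroupType) (G : {group gT}).

(* The [faithful] of the action library requires the set acted on to be a
   finType. *)
Definition faithful_action (Omega : Type) (to : action G Omega) : Prop :=
  forall a, a \in G -> (forall x, to x a = x) -> a = 1%g.

Definition perm_image (Omega : Type) (to : action G Omega) :
    set (Omega -> Omega) :=
  [set to^~ a | a in [set` G]].

Definition totally_kclosed (k : nat) : Prop :=
  forall (Omega : Type) (to : action G Omega),
    faithful_action to -> kclosed k (perm_image to).

End Representations.

(* Main.v *)
Require Import Defs.
From mathcomp Require Import boolp classical_sets.
From mathcomp Require Import all_boot all_fingroup all_solvable all_algebra.

Set Implicit Arguments.
Unset Strict Implicit.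
Unset Printing Implicit Defensive.

(** Suppose first that [G] contains [E] isomorphic to [Z_p^k]. The order bound
    makes [E] a Sylow subgroup, hence a direct factor of [G]. Take the [k + 1]
    linear forms [x_1, ..., x_k, x_1 + ... + x_k] on [Z_p^k]: any [k] of them
    are independent, but all [k + 1] are dependent. Let [G] translate [k + 1]
    copies of [Z_p] through these forms and act on the cosets of [E] to retain
    the complementary factor. Translating the last copy alone is not in the
    image of [G], yet any [k] points meet at most [k] copies and so cannot tell
    it from an element of [E]. It lies in the [k]-closure
    ([not_totally_kclosed_dprod_rV]).

    Conversely, suppose that no Sylow subgroup is [Z_p^k], and let [G] act
    faithfully. Every Sylow subgroup [P] has a base of fewer than [k] points.
    Each new point of a stabiliser chain divides the order by at least [p], so
    this is clear when [|P| < p^k]; and when [|P| = p^k], the Frattini subgroup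
    of [P] is nontrivial, and a point moved by it already divides the order by
    [p^2] ([pgroup_base], [pgroup_base_nonabelem]).

    If [g] is in the [k]-closure, then an element [h] of [G] that agrees with
    [g] on a base of the Sylow [p]-subgroup has a [p]-component determined by
    [g]. As the base has fewer than [k] points, [h] can be chosen to
    agree with [g] at any one further point as well. Multiplying these
    components over all [p] yields an [a] in [G]; for every point [x], the
    quotient of [a] by an [h] with [g x = x h] has all its primary components
    in the stabiliser of [x], so [a] and [g] agree at [x]
    ([nilpotent_kclosed]). *)

(** * Actions on arbitrary sets and their closures *)

Section Closure.

Variables (gT : finGroupType) (G : {group gT}).
Variables (Omega : Type) (to : action G Omega).

Lemma gactM x : {in G &, act_morph to x}.
Proof. by case: to => act /= [_ actM]; apply: actM. Qed.

Lemma gact1 x : to x 1%g = x.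
Proof.
have inj1 : injective (to^~ 1%g) by case: to => act /= [inj_act _]; apply: inj_act.
by apply: inj1; rewrite -gactM ?group1 // mulg1.
Qed.

Lemma gactK a : a \in G -> cancel (to^~ a) (to^~ a^-1%g).
Proof. by move=> Ga x; rewrite -gactM ?groupV // mulgV gact1. Qed.

Lemma gactKV a : a \in G -> cancel (to^~ a^-1%g) (to^~ a).
Proof. by move=> Ga x; rewrite -gactM ?groupV // mulVg gact1. Qed.

(** Inverses come for free: if [g] carries [u] to a tuple in the orbit of [u],
    then [u] lies in the orbit of its image, so preserving each orbit reduces
    to agreeing with a group element on every single tuple. *)
Lemma kclosureP k (g : Omega -> Omega) :
  kclosure k (perm_image to) g <->
  bijective g /\
  forall t : k.-tuple Omega,
    exists2 a, a \in G & [seq g x | x <- t] = [seq to x a | x <- t].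
Proof.
have orbit_mem (t u : k.-tuple Omega) : tuple_orbit (perm_image to) t u <->
    exists2 a, a \in G & tval u = [seq to x a | x <- t].
  split=> [[_ [a /= Ga <-] <-] | [a Ga eq_u]]; first by exists a.
  by exists (to^~ a); [exists a | apply: val_inj].
split=> [[bij_g clo_g] | [bij_g loc_g]].
  split=> // t; apply/(orbit_mem t (map_tuple g t)).
  rewrite -clo_g; exists t => //; apply/orbit_mem; exists 1%g => //.
  by rewrite (eq_map gact1) map_id.
split=> // t; apply/seteqP; split=> u.
  case=> v /orbit_mem[b Gb eq_v] <-; have [a Ga eq_g] := loc_g v.
  apply/orbit_mem; exists (b * a)%g; first exact: groupM.
  by rewrite /= eq_g eq_v -map_comp; apply: eq_map => x /=; rewrite gactM.
case: (bij_g) => f fK gK /orbit_mem[b Gb eq_u].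
have guK : map_tuple g (map_tuple f u) = u.
  by apply: val_inj; rewrite /= mapK.
exists (map_tuple f u) => //; have [a Ga eq_g] := loc_g (map_tuple f u).
apply/orbit_mem; exists (b * a^-1)%g; first by rewrite groupM ?groupV.
have eq_ua : tval u = [seq to x a | x <- map_tuple f u].
  by rewrite -eq_g; congr tval.
have -> : tval (map_tuple f u) = [seq to x a^-1%g | x <- u].
  by rewrite eq_ua mapK //; apply: gactK.
by rewrite eq_u -map_comp; apply: eq_map => x /=; rewrite gactM ?groupV.
Qed.

Lemma perm_image_kclosure k :
  (perm_image to `<=` kclosure k (perm_image to))%classic.
Proof.
move=> _ [a /= Ga <-]; apply/kclosureP; split; last by exists a.
by exists (to^~ a^-1%g); [apply: gactK | apply: gactKV].
Qed.

(** Sequences shorter than [k] are handled by repeating one of their entries. *)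
Lemma kclosure_seq k g (s : seq Omega) :
    kclosure k (perm_image to) g -> size s <= k ->
  exists2 a, a \in G & [seq g x | x <- s] = [seq to x a | x <- s].
Proof.
case: s => [|y s] /kclosureP[_ loc_g] le_sk; first by exists 1%g.
have size_t : size ((y :: s) ++ nseq (k - size (y :: s)) y) == k.
  by rewrite size_cat size_nseq subnKC.
have [a Ga /(congr1 (take (size (y :: s))))] := loc_g (Tuple size_t).
by rewrite -!map_take [tval _]/= -cat_cons take_size_cat //; exists a.
Qed.

(** * Bases *)

Definition stab (s : seq Omega) :=
  [set a in G | `[<[seq to x a | x <- s] = s>]]%SET.

Lemma stabP s a : reflect (a \in G /\ [seq to x a | x <- s] = s) (a \in stab s).
Proof. by rewrite inE; apply: (iffP andP) => -[Ga /asboolP]. Qed.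

Lemma group_set_stab s : group_set (stab s).
Proof.
apply/group_setP; split=> [|a b].
  by apply/stabP; rewrite (eq_map gact1) map_id.
move=> /stabP[Ga as_] /stabP[Gb bs_]; apply/stabP; split; first exact: groupM.
rewrite -[RHS]bs_ -[in RHS]as_ -map_comp.
by apply: eq_map => x /=; rewrite gactM.
Qed.

Canonical stab_group s := Group (group_set_stab s).

Lemma stab_cons x s : stab (x :: s) = (stab [:: x] :&: stab s)%g.
Proof.
apply/setP => a; rewrite in_setI; apply/stabP/andP => [[Ga [ax as_]] | ].
  by split; apply/stabP; rewrite /= ?ax.
by case=> /stabP[Ga [ax]] /stabP[_ as_]; rewrite /= ax as_.
Qed.

Definition base (H : {set gT}) (s : seq Omega) := (H :&: stab s = 1)%g.

Lemma base_cons (H : {set gT}) x s :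
  base (H :&: stab [:: x])%g s -> base H (x :: s).
Proof. by rewrite /base (stab_cons x s) setIA. Qed.

Hypothesis ffulG : faithful_action to.

Lemma moved_point (a : gT) : a \in G -> a != 1%g -> exists x, a \notin stab [:: x].
Proof.
move=> Ga nta; apply: contrapT => no_x; case/eqP: nta; apply: ffulG => // x.
by apply: contrapT => ax; apply: no_x; exists x; apply/stabP => -[_ []].
Qed.

(** Stabilising one more moved point lowers the order of a [p]-group by a
    factor of at least [p]. *)
Lemma pgroup_base (p : nat) (H : {group gT}) n :
    (p.-group H)%g -> H \subset G -> logn p #|H| <= n ->
  exists2 s, size s <= n & base H s.
Proof.
elim: n H => [|n IHn] H pH sHG leHn; have [H1 | ] := eqVneq (H : {set gT}) 1%g.
- by exists [::] => //; rewrite /base H1; apply: (setIidPl _); apply: sub1G.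
- by rewrite -proper1G => /(properG_ltn_log pH)/leq_trans/(_ leHn).
- by exists [::] => //; rewrite /base H1; apply: (setIidPl _); apply: sub1G.
case/trivgPn=> a Ha nta.
have [x ax] := moved_point (subsetP sHG a Ha) nta.
have prK : (H :&: stab [:: x])%g \proper H.
  by rewrite properEneq subsetIl andbT; apply: contraNneq ax => /setIidPl/subsetP->.
have [] := IHn (H :&: stab [:: x])%G; rewrite ?(pgroupS (proper_sub prK)) //.
- exact: subset_trans (proper_sub prK) sHG.
- by rewrite -ltnS (leq_trans _ leHn) // properG_ltn_log.
by move=> s le_s base_s; exists (x :: s); last exact: base_cons.
Qed.

(** A point moved by a nontrivial element of the Frattini subgroup has a
    stabiliser that is neither [H] nor maximal, hence has index at least
    [p ^ 2]: this first point counts for two steps of the stabiliser chain. *)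
Lemma pgroup_base_nonabelem (p : nat) (H : {group gT}) n :
    prime p -> (p.-group H)%g -> H \subset G -> ~~ (p.-abelem H)%g ->
    logn p #|H| <= n.+1 ->
  exists2 s, size s <= n & base H s.
Proof.
move=> p_pr pH sHG; rewrite -(trivg_Phi pH) => ntPhi leHn.
have [a Phia nta] := trivgPn 'Phi(H)%G ntPhi.
have Ha : a \in H := subsetP (Phi_sub H) a Phia.
have [x ax] := moved_point (subsetP sHG a Ha) nta.
pose K := (H :&: stab [:: x])%G.
have aK : a \notin K by rewrite inE Ha.
have sKH : K \subset H := subsetIl _ _.
have pK : (p.-group K)%g := pgroupS sKH pH.
have ltKH : logn p #|K| < logn p #|H|.
  rewrite properG_ltn_log // properEneq sKH andbT.
  by apply: contraNneq aK => ->.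
have lt2KH : (logn p #|K|).+1 < logn p #|H|.
  rewrite ltn_neqAle ltKH andbT; apply: contraNneq aK => eq_log.
  suffices maxK : maximal K H by apply: subsetP (Phi_sub_max maxK) a Phia.
  apply: p_index_maximal => //.
  suffices -> : #|H : K|%g = p by [].
  have /eqP := Lagrange sKH; rewrite (card_pgroup pH) -eq_log expnS mulnC.
  by rewrite -(card_pgroup pK) eqn_pmul2r ?cardG_gt0 // => /eqP.
have [|s le_s base_s] := @pgroup_base p K n.-1 pK (subset_trans sKH sHG).
  by case: (n) leHn (leq_trans lt2KH leHn).
exists (x :: s); last exact: base_cons.
by case: (n) leHn (leq_trans lt2KH leHn) le_s.
Qed.

End Closure.

(** * Assembling Sylow components in a nilpotent group *)

(** [G] is the direct product of its [pi]- and [pi']-cores, and taking the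
    [pi]-component is the projection onto the first. *)
Lemma nilpotent_consttM (gT : finGroupType) (G : {group gT}) (pi : nat_pred) :
  nilpotent G -> {in G &, {morph (fun x => x.`_pi)%g : x y / (x * y)%g}}.
Proof.
move=> nilG; have [_ defG cPQ _] := dprodP (nilpotent_pcoreC pi nilG).
have ppartE u v : u \in 'O_pi(G)%g -> v \in 'O_pi^'(G)%g -> ((u * v).`_pi)%g = u.
  move=> Pu Qv; have cuv : commute u v by apply/esym/(centP (subsetP cPQ v Qv)).
  rewrite consttM // constt_p_elt ?(mem_p_elt (pcore_pgroup _ _) Pu) //.
  by rewrite (constt1P _) ?mulg1 ?(mem_p_elt (pcore_pgroup _ _) Qv).
move=> x y; rewrite -{1 2}defG => /mulsgP[u v Pu Qv ->] /mulsgP[w z Pw Qz ->].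
have cvw : commute w v := esym (centP (subsetP cPQ v Qv) w Pw).
have -> : (u * v * (w * z) = u * w * (v * z))%g.
  by rewrite -!mulgA (mulgA v) -cvw !mulgA.
by rewrite [LHS]ppartE ?groupM // !ppartE.
Qed.

Lemma mem_constt (gT : finGroupType) (G : {group gT}) (pi : nat_pred) x :
  x \in G -> (x.`_pi)%g \in G.
Proof. by move=> Gx; rewrite (subsetP _ _ (cycle_constt pi x)) ?cycle_subG. Qed.

(** Components at distinct primes do not interfere in the product of all the
    [c p]. The range of primes bounds that of [prod_constt] for every element
    of [G]. *)
Lemma nilpotent_glue_constt (gT : finGroupType) (G : {group gT}) (c : nat -> gT) :
    nilpotent G -> (forall p, c p \in G) -> (forall p : nat, (p.-elt (c p))%g) ->
  exists2 a, a \in G & forall p : nat, p < #|G|.+1 -> (a.`_p)%g = c p.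
Proof.
move=> nilG Gc pc; exists (\prod_(0 <= p < #|G|.+1) c p)%g.
  by apply: group_prod => p _; apply: Gc.
move=> q ltq; pose K (x y : gT) := x \in G /\ (x.`_q)%g = y.
suffices [_ ->] : K (\prod_(0 <= p < #|G|.+1) c p)%g
                    (\prod_(0 <= p < #|G|.+1 | p == q) c p)%g.
  by rewrite big_nat1_eq ltq.
rewrite [X in K _ X]big_mkcond; apply: big_rec2 => [|p y x _ [Gx <-]].
  by split; rewrite ?group1 ?constt1.
split; first by rewrite groupM.
rewrite (nilpotent_consttM _ nilG) //; congr (_ * _)%g.
have [<-|neq_pq] := eqVneq p q; first exact: constt_p_elt.
apply/constt1P; apply: sub_in_pnat (pc p) => r _; rewrite !inE => /eqP->.
exact: neq_pq.
Qed.

(** The bases for distinct primes may be unrelated, so no bounded set of points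
    determines an element of [G]; only one primary component is recovered from
    each base. The strict bound on the size of a base leaves room for one more
    point in a [k]-tuple. *)
Lemma nilpotent_kclosed (gT : finGroupType) (G : {group gT}) (Omega : Type)
    (to : action G Omega) k :
    nilpotent G ->
    (forall p : nat, exists2 s : seq Omega, size s < k & base to 'O_p(G)%g s) ->
  kclosed k (perm_image to).
Proof.
move=> nilG bases; apply/seteqP; split; last exact: perm_image_kclosure.
move=> g clo_g.
(* The component [c] must not depend on [x]: it is that of an [h0] that agrees
   with [g] on the base alone. *)
have agree (p : nat) : exists c, [/\ c \in G, (p.-elt c)%g &
    forall x, exists2 h, h \in G & (h.`_p)%g = c /\ g x = to x h].
  have [s lt_sk base_s] := bases p.
  have [h0 Gh0 h0s] := kclosure_seq clo_g (ltnW lt_sk).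
  exists (h0.`_p)%g; split=> [||x]; rewrite ?mem_constt ?p_elt_constt //.
  have [h Gh [hx hs]] := kclosure_seq (s := x :: s) clo_g lt_sk.
  exists h => //; split=> //; apply/eqP; rewrite eq_mulgV1 -consttV.
  rewrite -(nilpotent_consttM _ nilG) ?groupV //; apply/eqP/set1gP; rewrite -base_s in_setI.
  have Ghh0 : (h * h0^-1)%g \in G by rewrite groupM ?groupV.
  rewrite (mem_Hall_pcore (nilpotent_pcore_Hall _ nilG)) ?mem_constt ?p_elt_constt //.
  apply/stabP; split=> //.
  rewrite -[RHS](mapK (gactK to Gh0)) -h0s hs -map_comp.
  by apply: eq_map => y; rewrite /= gactM ?groupV.
have k_gt0 : 0 < k by have [s /(leq_ltn_trans (leq0n _))] := bases 0.
have [c cP] := choice agree.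
have [|p|a Ga aP] := @nilpotent_glue_constt _ G c nilG.
- by move=> p; case: (cP p).
- by case: (cP p).
exists a => //; apply/funext => x.
have [h0 Gh0 [gx]] := kclosure_seq (s := [:: x]) clo_g k_gt0.
suffices /stabP[_ [ax]] : (a * h0^-1)%g \in stab to [:: x].
  by rewrite gx -[in RHS]ax gactM ?groupV // gactKV.
have Gah0 : (a * h0^-1)%g \in G by rewrite groupM ?groupV.
rewrite -[(a * h0^-1)%g]prod_constt big_nat_cond.
apply: group_prod => p /andP[/andP[_ lt_p] _].
have [_ _ /(_ x)[h Gh [hc hx]]] := cP p.
rewrite (nilpotent_consttM _ nilG) ?groupV // consttV aP; last first.
  by rewrite (leq_trans lt_p) // ltnS dvdn_leq ?order_dvdG.
rewrite -hc -consttV -(nilpotent_consttM _ nilG) ?groupV //; apply: mem_constt.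
apply/stabP; rewrite groupM ?groupV //; split=> //=.
by rewrite gactM ?groupV // -hx gx gactK.
Qed.

(** * Elementary abelian direct factors *)

Lemma elementary_abelian_rV p k : prime p ->
  (p.-abelem [set: 'rV['Z_p]_k])%g /\ #|[set: 'rV['Z_p]_k]| = p ^ k.
Proof.
move=> p_pr; split; last by rewrite cardsT card_mx mul1n card_ord Zp_cast ?prime_gt1.
rewrite abelemE // FinRing.zmod_abelian; apply/exponentP => v _.
rewrite FinRing.zmodXgE; apply/matrixP => i j; rewrite !mxE.
by rewrite mulmxnE -GRing.mulr_natr pchar_Zp ?prime_gt1 // GRing.mulr0.
Qed.

Section DirectFactor.

Variables (p k : nat) (gT : finGroupType) (G E Q : {group gT}).
Variable f : {morphism E >-> 'rV['Z_p]_k}.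
Hypotheses (defG : (E \x Q = G)%g) (injf : ('injm f)%g).
Hypothesis f_onto : (f @* E = [set: 'rV['Z_p]_k])%g.

Lemma coord_subproof : (trivm Q @* Q \subset 'C(f @* E))%g.
Proof. by rewrite morphim_trivm sub1G. Qed.

(** The projection onto [E] along [Q], read in coordinates. *)
Definition coord : {morphism G >-> 'rV['Z_p]_k} :=
  dprodm_morphism defG coord_subproof.

Lemma coord_onto v : exists2 a, a \in E & coord a = v.
Proof.
have /morphimP[a _ Ea ->] : v \in (f @* E)%g by rewrite f_onto inE.
by exists a; rewrite //= dprodmEl.
Qed.

Lemma coord_inj a : a \in E -> coord a = 0%R -> a = 1%g.
Proof.
move=> Ea; rewrite /= dprodmEl // => fa0.
by apply: (injmP injf); rewrite ?group1 // morph1.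
Qed.

Lemma coordM : {in G &, {morph coord : a b / (a * b)%g >-> (a + b)%R}}.
Proof. exact: morphM. Qed.

(** Together, the coordinates and their sum are [k + 1] vectors in general
    position in the dual of [Z_p^k]. *)
Definition form (j : option 'I_k) (v : 'rV['Z_p]_k) : 'Z_p :=
  if j is Some i then v 0%R i else (\sum_i v 0 i)%R.

Lemma formD j : {morph form j : u v / (u + v)%R}.
Proof.
case: j => [i|] u v; rewrite /= ?mxE // -big_split /=.
by apply: eq_bigr => i _; rewrite mxE.
Qed.

(** Any [k] of the [k + 1] forms are independent, so their values can be those
    required of the shift; the omitted form takes whatever value results. *)
Lemma form_dual_vector j0 : exists v, forall j, j != j0 ->
  form j v = (j == None)%:R%R.
Proof.
case: j0 => [i0|]; last first.
  by exists 0%R => -[i|//] _; rewrite /= mxE.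
exists (delta_mx 0 i0)%R => -[i|] /= neq_j; last first.
  rewrite (bigD1 i0) //= mxE !eqxx big1 ?GRing.addr0 // => i ne_i.
  by rewrite mxE (negPf ne_i) andbF.
rewrite mxE; case: eqP => //= _.
by rewrite (negPf (_ : i != i0)) //.
Qed.

(** The cosets of [E] serve only to make the action of [Q] faithful. *)
Definition line_space : Type := ((option 'I_k * 'Z_p) + coset_of E)%type.

Definition line_act (x : line_space) (a : gT) : line_space :=
  match x with
  | inl (j, z) => inl (j, (z + form j (coord a))%R)
  | inr y => inr (y * coset E a)%g
  end.

Lemma line_act_is_action : is_action G line_act.
Proof.
have nEG : G \subset 'N(E)%g by case/dprod_normal2: defG => /andP[].
split=> [a | [[j z]|y] a b Ga Gb /=].
- apply: (can_inj (g := fun x : line_space => match x with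
    | inl (j, z) => inl (j, (z - form j (coord a))%R)
    | inr y => inr (y * (coset E a)^-1)%g
    end)).
  by case=> [[j z]|y]; rewrite /line_act ?GRing.addrK ?mulgK.
- by rewrite coordM // formD GRing.addrA.
- by rewrite morphM ?(subsetP nEG) // mulgA.
Qed.

Definition line_action := Action line_act_is_action.

Lemma line_action_faithful : faithful_action line_action.
Proof.
have nEG : G \subset 'N(E)%g by case/dprod_normal2: defG => /andP[].
move=> a Ga fix_a; apply: coord_inj.
  have := inr_inj (fix_a (inr 1%g)); rewrite mul1g => Ea1.
  by rewrite coset_idr // (subsetP nEG).
apply/rowP => i; rewrite [RHS]mxE.
have := congr1 snd (inl_inj (fix_a (inl (Some i, 0%R)))).
by move=> /= fix0; rewrite -[LHS]GRing.add0r.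
Qed.

Definition shift (x : line_space) : line_space :=
  if x is inl (j, z) then inl (j, (z + (j == None)%:R)%R) else x.

Lemma shift_bijective : bijective shift.
Proof.
exists (fun x : line_space =>
  if x is inl (j, z) then inl (j, (z - (j == None)%:R)%R) else x).
- by case=> [[j z]|y] //=; rewrite GRing.addrK.
- by case=> [[j z]|y] //=; rewrite GRing.subrK.
Qed.

(** All coordinates of a group element acting as [shift] would vanish, while
    their sum would be [1]. *)
Lemma shift_not_perm_image : ~ perm_image line_action shift.
Proof.
case=> a /= Ga eq_a; have eq_form j : form j (coord a) = (j == None)%:R%R.
  have := congr1 (fun h => h (inl (j, 0%R))) eq_a.
  by move=> e; have := congr1 snd (inl_inj e); rewrite /= !GRing.add0r.
have coord0 i : coord a 0%R i = 0%R by rewrite -[LHS]/(form (Some i) _) eq_form.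
have /eqP := eq_form None; rewrite /= big1 => [|i _]; last exact: coord0.
by rewrite eq_sym GRing.oner_eq0.
Qed.

(** By the pigeonhole principle [k] points miss some copy [j0] of [Z_p]; the
    dual vector for [j0] then imitates the shift on all of them, and it
    comes from [E], which fixes every coset of [E]. *)
Lemma shift_kclosure : kclosure k (perm_image line_action) shift.
Proof.
apply/kclosureP; split=> [|t]; first exact: shift_bijective.
pose idx (x : line_space) := if x is inl (j, _) then Some j else None.
have [j0 j0t] : exists j0, j0 \notin pmap idx t.
  apply/existsP; rewrite -negb_forall; apply/negP => /forallP all_t.
  have : #|{: option 'I_k}| <= #|pmap idx t|.
    by apply/subset_leq_card/subsetP => j _; apply: all_t.
  rewrite card_option card_ord leqNgt ltnS => /negP; apply.
  apply: leq_trans (card_size _) _; rewrite size_pmap.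
  by rewrite -[X in _ <= X](size_tuple t) count_size.
have [v v_form] := form_dual_vector j0; have [a Ea coord_a] := coord_onto v.
have [_ defG' _ _] := dprodP defG.
exists a; first by rewrite -defG' (subsetP (mulG_subl _ _)).
move: j0t; rewrite mem_pmap; elim: (tval t) => // x s IHs.
rewrite [map _ _]/= inE negb_or => /andP[j0x /IHs eq_s].
rewrite /= eq_s; congr (_ :: _); case: x j0x => [[j z]|y] /= j0x.
  by rewrite coord_a v_form //; apply: contraNneq j0x => ->.
by rewrite coset_id ?mulg1.
Qed.

End DirectFactor.


Lemma not_totally_kclosed_dprod_rV p k (gT : finGroupType) (G E Q : {group gT}) :
  (E \x Q = G)%g -> (E \isog [set: 'rV['Z_p]_k])%g -> ~ totally_kclosed G k.
Proof.
move=> defG /isogP[f injf f_onto] tot_G.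
case: (@shift_not_perm_image _ _ _ _ _ _ f defG).
rewrite -(tot_G _ _ (line_action_faithful (defG := defG) injf)).
exact: shift_kclosure.
Qed.

Theorem theoremB (k : nat) (gT : finGroupType) (G : {group gT}) :
  0 < k ->
  nilpotent G ->
  (forall p : nat, prime p -> p %| #|G| ->
     forall P : {group gT}, (p.-Sylow(G) P)%g -> #|P| <= p ^ k) ->
  (totally_kclosed G k <->
   forall p : nat, prime p ->
     ~ exists E : {group gT}, E \subset G /\ (E \isog [set: 'rV['Z_p]_k])%g).
Proof.
move=> k_gt0 nilG le_Sylow; split=> [tot_G p p_pr [E [sEG isoE]] | no_rV].
  have [abelV cardV] := elementary_abelian_rV k p_pr.
  have cardE : #|E| = p ^ k by rewrite (card_isog isoE).
  have p_dv_G : p %| #|G|.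
    by rewrite (dvdn_trans _ (cardSg sEG)) // cardE -(prednK k_gt0) expnS dvdn_mulr.
  have pE : (p.-group E)%g by rewrite /pgroup cardE pnatX pnat_id.
  have [P sylP sEP] := Sylow_superset sEG pE.
  have defE : E = 'O_p(G)%G.
    apply: val_inj; rewrite /= -(nilpotent_Hall_pcore nilG sylP).
    by apply/eqP; rewrite eqEcard sEP cardE le_Sylow.
  apply: not_totally_kclosed_dprod_rV isoE tot_G.
  by rewrite defE; apply: nilpotent_pcoreC.
move=> Omega to ffulG; apply: nilpotent_kclosed => // p.
have sylP : (p.-Sylow(G) 'O_p(G))%g := nilpotent_pcore_Hall _ nilG.
have [p_G | p'G] := boolP (p \in \pi(G)); last first.
  exists [::]; rewrite // /base.
  suffices -> : 'O_p(G)%g = 1%g by apply: (setIidPl _); apply: sub1G.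
  apply/eqP; rewrite trivg_card1 (card_Hall sylP) p_part.
  by rewrite (eqP (_ : logn p #|G| == 0)) // -leqn0 leqNgt logn_gt0.
have [p_pr _ p_dv_G] : [/\ prime p, 0 < #|G| & p %| #|G|].
  by apply/and3P; rewrite -mem_primes.
have pP := pcore_pgroup p G; have sPG := pcore_sub p G.
have le_logP : logn p #|'O_p(G)%g| <= k.
  by rewrite -(leq_exp2l _ _ (prime_gt1 p_pr)) -card_pgroup ?le_Sylow.
rewrite -(prednK k_gt0).
have [abelP | nabelP] := boolP (p.-abelem 'O_p(G))%g; last first.
  by apply: (pgroup_base_nonabelem ffulG p_pr pP sPG nabelP); rewrite prednK.
apply: (pgroup_base ffulG pP sPG); rewrite -ltnS prednK // ltn_neqAle le_logP andbT.
apply/eqP => eq_log; case: (no_rV p p_pr); exists 'O_p(G)%G; split=> //.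
have [abelV cardV] := elementary_abelian_rV k p_pr.
by rewrite (isog_abelem_card _ abelP) abelV cardV -eq_log -card_pgroup /=.
Qed.
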